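(* For $\sigma\in S_n(132)$, let $L^{U^3D}_n(\sigma)$ denote the length of the longest subsequence of $\sigma$ that repeats the up/down pattern $UUUD$ (so $L^{U^3D}_n(\sigma)$ is either equal to $0$ or to $4k+1$ for some $k\in\mathbb{N}$). Then $$E_n^{\text{av}(132)}L^{U^3D}_n\sim\frac4{11} n\quad\text{as } n\to\infty.$$
   Context: $S_n$ is the set of permutations $\sigma=\sigma_1\cdots\sigma_n$ of $[n]=\{1,\dots,n\}$. A permutation $\sigma\in S_n$ avoids $\tau\in S_3$ if there are no indices $i_1<i_2<i_3$ such that $\sigma_{i_1}\sigma_{i_2}\sigma_{i_3}$ is in the same relative order as $\tau_1\tau_2\tau_3$; $S_n(\tau)$ is the set of $\sigma\in S_n$ avoiding $\tau$. $P_n^{\text{av}(\tau)}$ is the uniform probability measure on $S_n(\tau)$ and $E_n^{\text{av}(\tau)}$ is the corresponding expectation. To a subsequence $\sigma_{i_1},\dots,\sigma_{i_m}$ ($i_1<\cdots<i_m$, $m\ge 2$) of $\sigma$ associate the up/down sequence $V_1\cdots V_{m-1}$, where $V_j=U$ if $\sigma_{i_{j+1}}>\sigma_{i_j}$ and $V_j=D$ if $\sigma_{i_{j+1}}<\sigma_{i_j}$. For a fixed up/down pattern $W=W_1\cdots W_l$ with $W_j\in\{U,D\}$, a subsequence repeats the pattern $W$ if its up/down sequence is $W$ concatenated with itself $k$ times for some $k\in\mathbb{N}=\{1,2,\dots\}$ (so it has length $kl+1$; incomplete patterns are not counted). The length of the longest subsequence repeating $W$ is the maximum such $kl+1$, and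 is $0$ if no such subsequence exists. The notation $x_n\sim y_n$ means $x_n/y_n\to1$ as $n\to\infty$. *)

(* Defs.v *)
From HB Require Import structures.
From mathcomp Require Import all_boot all_order all_algebra all_fingroup.
From mathcomp Require Import all_classical all_reals all_analysis.
Set Implicit Arguments.
Unset Strict Implicit.
Unset Printing Implicit Defensive.
Import Order.TTheory GRing.Theory Num.Theory.
Import numFieldNormedType.Exports.
Local Open Scope classical_set_scope.
Local Open Scope ring_scope.

(* Permutations of [n] are elements of 'S_n, i.e. permutations of
   'I_n = {0, ..., n-1}: positions and values are both shifted down by 1. *)

Definition contains (k n : nat) (tau : 'S_k) (sigma : 'S_n) : bool :=
  [exists i : {ffun 'I_k -> 'I_n},
    [forall a : 'I_k, forall b : 'I_k, (a < b)%N ==> (i a < i b)%N] &&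
    [forall a : 'I_k, forall b : 'I_k,
      (sigma (i a) < sigma (i b))%N == (tau a < tau b)%N]].

Definition avoiders (k : nat) (tau : 'S_k) (n : nat) : {set 'S_n} :=
  [set sigma : 'S_n | ~~ contains tau sigma].

(* One-line notation 132: fixes the first letter, swaps the other two. *)
Definition tau132 : 'S_3 := tperm (inord 1) (inord 2).

(* Expectation under the uniform probability measure on S_n(tau). *)
Definition Eav (R : realType) (k : nat) (tau : 'S_k) (n : nat)
    (X : 'S_n -> R) : R :=
  (\sum_(sigma in avoiders tau n) X sigma) / #|avoiders tau n|%:R.

(* Up/down letters are booleans, true for U and false for D. *)
Notation U := true (only parsing).
Notation D := false (only parsing).

Definition updown (s : seq nat) : seq bool :=
  if s is x :: s' then pairmap ltn x s' else [::].

Definition repeats (W : seq bool) (s : seq nat) : Prop :=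
  exists2 k : nat, (0 < k)%N & updown s = flatten (nseq k W).

(* A subsequence is given by its set A of positions; enum A is increasing. *)
Definition subword (n : nat) (sigma : 'S_n) (A : {set 'I_n}) : seq nat :=
  [seq nat_of_ord (sigma i) | i <- enum A].

(* The maximum over an empty family is 0. *)
Definition longest_repeating (W : seq bool) (n : nat) (sigma : 'S_n) : nat :=
  (\max_(A : {set 'I_n} | `[< repeats W (subword sigma A) >]) #|A|)%N.

Definition asymp_equiv (R : realType) (x y : nat -> R) : Prop :=
  (fun n : nat => x n / y n) @ \oo --> (1 : R).

(* Main.v *)
(* Splitting a 132-avoiding permutation at its maximum writes it as L m R with
   every letter of L above every letter of R, so 132-avoiding permutations are
   binary trees. Let [best t] be the maximal length of a subsequence whose
   up/down sequence is a prefix of (UUUD)^oo; it differs from the length of the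
   longest subsequence repeating UUUD by at most 4. It is computed by recursion
   on the tree: no U can join L m to R, and m can only be appended after L by a
   U. Hence [best t %/ 4] counts the nodes whose left subtree l satisfies
   [best l %% 4 = 3].

   For a fixed tree u with k nodes, the trees with n nodes contain in total
   (2(n-k-1)+1) C_(n-k-1) nodes with left subtree u, i.e. an asymptotic
   proportion 4^-k / 2 of all n C_n nodes. These proportions sum to 1, so by
   Scheffe's argument (lower bounds for an event and for its complement) the
   proportion of nodes with [best l %% 4 = 3] tends to the sum of 4^-|l| / 2 over
   such l. Since [best] acts through finitely many states, the weights of the
   states solve a polynomial system, whose solution gives 1/11. *)
Require Import Defs.
From HB Require Import structures.
From mathcomp Require Import all_boot all_order all_algebra all_fingroup.
From mathcomp Require Import zify ring lra.
From mathcomp Require Import all_classical all_reals all_analysis.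
Set Implicit Arguments.
Unset Strict Implicit.
Unset Printing Implicit Defensive.
Import Order.TTheory GRing.Theory Num.Theory.
Import numFieldNormedType.Exports.
Local Open Scope nat_scope.

(** * Binary trees and 132-avoiding permutations *)

Inductive tree := Leaf | Node of tree & tree.

Fixpoint tree_eqb (t u : tree) : bool :=
  match t, u with
  | Leaf, Leaf => true
  | Node l r, Node l' r' => tree_eqb l l' && tree_eqb r r'
  | _, _ => false
  end.

Lemma tree_eqP : Equality.axiom tree_eqb.
Proof.
elim=> [|l IHl r IHr] [|l' r'] /=; try by constructor.
by apply: (iffP andP) => [[/IHl -> /IHr ->]|[/IHl ? /IHr ?]].
Qed.

HB.instance Definition _ := hasDecEq.Build tree tree_eqP.

Fixpoint nodes (t : tree) : nat :=
  if t is Node l r then (nodes l + nodes r).+1 else 0.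

Fixpoint word (t : tree) : seq nat :=
  if t is Node l r then
    [seq nodes r + i | i <- word l] ++ (nodes l + nodes r) :: word r
  else [::].

Lemma size_word t : size (word t) = nodes t.
Proof. by elim: t => //= l IHl r IHr; rewrite size_cat size_map /= IHl IHr addnS. Qed.

Lemma perm_word t : perm_eq (word t) (iota 0 (nodes t)).
Proof.
elim: t => // l IHl r IHr; rewrite [word _]/=.
have -> : nodes (Node l r) = nodes l + nodes r + 1 by rewrite addn1.
rewrite iotaD add0n -cat1s perm_catCA perm_sym.
rewrite perm_catC perm_cat2l addnC iotaD add0n perm_catC perm_cat 1?perm_sym //.
by rewrite -[X in iota X _]addn0 iotaDl perm_map.
Qed.

Lemma mem_word t x : (x \in word t) = (x < nodes t).
Proof. by rewrite (perm_mem (perm_word t)) mem_iota. Qed.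

(** The maximum of [word (Node l r)] occurs only once, at index [nodes l], so its position recovers
    the sizes of both subtrees and hence the two blocks around it. *)
Lemma word_inj : injective word.
Proof.
elim=> [|l IHl r IHr] [|l' r'] //= E.
- by case: (word l') E.
- by case: (word l) E.
have Es : nodes l + nodes r = nodes l' + nodes r'.
  by move/(congr1 size): E; rewrite !size_cat /= !size_map !size_word; lia.
have nin l1 r1 : nodes l1 + nodes r1 \notin [seq nodes r1 + i | i <- word l1].
  by apply/mapP => -[x]; rewrite mem_word; lia.
have El : nodes l = nodes l'.
  have : index (nodes l + nodes r) (word (Node l r)) = nodes l.
    by rewrite /= index_cat (negPf (nin _ _)) /= eqxx size_map size_word addn0.
  by rewrite /= E Es index_cat (negPf (nin _ _)) /= eqxx size_map size_word addn0.
have Er : nodes r = nodes r' by lia.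
move/eqP: E; rewrite eqseq_cat ?size_map ?size_word // => /andP[/eqP E1 /eqP[_ E2]].
move: E1; rewrite Er => /(inj_map (@addnI _)) /IHl ->.
by rewrite (IHr _ E2).
Qed.

Lemma subseq_cat_split (u s1 s2 : seq nat) :
  subseq u (s1 ++ s2) ->
  exists u1 u2, [/\ u = u1 ++ u2, subseq u1 s1 & subseq u2 s2].
Proof.
elim: s1 u => [|x s1 IH] u /=; first by exists [::], u.
case: u => [|y u] /=.
  by exists [::], [::]; rewrite ?sub0seq.
case: eqP => [->|_] /IH[u1 [u2 [E S1 S2]]].
  by exists (x :: u1), u2; rewrite /= eqxx -E.
exists u1, u2; split=> //; exact: subseq_trans S1 (subseq_cons _ _).
Qed.

Definition avoids132 (s : seq nat) : Prop :=
  forall a b c, subseq [:: a; b; c] s -> ~~ (a < c < b).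

Lemma avoids132_shift k s :
  avoids132 [seq k + i | i <- s] <-> avoids132 s.
Proof.
split=> A a b c.
  by move=> /(map_subseq (addn k)) /A; rewrite !ltn_add2l.
move=> /subseqP[m _]; rewrite -map_mask.
case E: (mask m s) => [|x [|y [|z []]]] //= [-> -> ->].
rewrite !ltn_add2l; apply: A; rewrite -E; exact: mask_subseq.
Qed.

Lemma word_avoids132 t : avoids132 (word t).
Proof.
elim: t => [|l IHl r IHr] /= a b c //.
have {}IHl : avoids132 [seq nodes r + i | i <- word l] by apply/avoids132_shift.
have ltr x : x \in word r -> x < nodes r by rewrite mem_word.
have gel x : x \in [seq nodes r + i | i <- word l] ->
    nodes r <= x < nodes l + nodes r.
  by case/mapP=> y; rewrite mem_word => ? ->; lia.
have in2 x y z s : subseq [:: x; y] (z :: s) -> y \in s.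
  by rewrite /=; case: eqP => _; rewrite -?sub1seq // => /(cons_subseq).
case/subseq_cat_split=> u1 [u2 [E S1 S2]].
(* Cases by the number of the three letters lying in the left block. With none to two of them there,
   [c] is the maximum, or [a] is, or [c] lies in the right block below [a], or all three lie in the
   right block; none of these leaves a new 132. *)
case: u1 E S1 => [|a' [|b' [|c' [|? ?]]]] //= E S1.
- rewrite -{}E in S2; move: S2 => /=; case: eqP => [-> S2|_ /IHr //].
  by have /ltr /= := mem_subseq S2 (mem_last _ _); lia.
- case: E S1 S2 => <- <- S1 /in2 /ltr cr; move: S1; rewrite sub1seq => /gel; lia.
- case: E S1 S2 => <- <- <- S1; rewrite sub1seq inE => S2.
  have /gel := mem_subseq S1 (mem_head _ _).
  have /gel := mem_subseq S1 (mem_last _ _) => /=.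
  by case/orP: S2 => [/eqP ->|/ltr]; lia.
- by case: E S1 => <- <- <- _; exact: IHl.
Qed.

Lemma avoids132_subseq s1 s2 : subseq s1 s2 -> avoids132 s2 -> avoids132 s1.
Proof. by move=> S A a b c H; apply: A; apply: subseq_trans H S. Qed.

(** Strong induction, cutting [s] at its maximum: avoidance forces every letter before the maximum
    above every letter after it, so both pieces are, up to a shift, permutations of initial
    segments. *)
Lemma avoids132_word n s :
  perm_eq s (iota 0 n) -> avoids132 s -> exists t, word t = s.
Proof.
elim/ltn_ind: n s => -[|n] IH s Ps As.
  by exists Leaf; rewrite (perm_nilP Ps).
have Us : uniq s by rewrite (perm_uniq Ps) iota_uniq.
have ns : n \in s by rewrite (perm_mem Ps) mem_iota /=.
case/splitPr: ns Ps As Us => s1 s2 Ps As Us.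
have P12 : perm_eq (s2 ++ s1) (iota 0 n).
  move: Ps; rewrite -cat1s perm_catCA perm_sym -addn1 iotaD add0n /= perm_catC.
  by rewrite /= perm_cons perm_sym perm_catC.
have lt12 x y : y \in s1 -> x \in s2 -> x < y.
  move=> y1 x2.
  (* If [y < x], the letters [y], [n], [x] would form a 132. *)
  have S : subseq [:: y; n; x] (s1 ++ n :: s2).
    by apply: (@cat_subseq _ [:: y] [:: n; x]); rewrite ?sub1seq //= eqxx sub1seq.
  have xn : x < n.
    have : x \in iota 0 n by rewrite -(perm_mem P12) mem_cat x2.
    by rewrite mem_iota.
  have ne : x != y.
    have := Us; rewrite cat_uniq => /and3P[_ /hasPn H _].
    by have := H x; rewrite inE x2 orbT => /(_ isT); apply: contraNneq => ->.
  by have := As _ _ _ S; lia.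
(* Sorting the blocks separately already sorts the whole, so [s2] holds exactly the smallest values
   and [s1] the remaining ones. *)
have Es : sort leq s2 ++ sort leq s1 = iota 0 n.
  apply: (sorted_eq leq_trans anti_leq); last 1 first.
  - apply: perm_trans P12; apply: perm_cat; exact: permEl (perm_sort _ _).
  - rewrite sorted_pairwise; last exact: leq_trans.
    rewrite pairwise_cat -!sorted_pairwise; try exact: leq_trans.
    rewrite !sort_sorted ?andbT; try exact: leq_total.
    apply/allrelP => x y; rewrite !mem_sort => x2 y1; exact/ltnW/lt12.
  - exact: iota_sorted.
have Sn : size s2 + size s1 = n.
  by have := congr1 size Es; rewrite size_cat !size_sort size_iota.
move: Es; rewrite -Sn iotaD add0n => /eqP.
rewrite eqseq_cat ?size_sort ?size_iota // => /andP[/eqP E2 /eqP E1].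
have P2 : perm_eq s2 (iota 0 (size s2)).
  by rewrite -E2 perm_sym; exact: permEl (perm_sort _ _).
have P1 : perm_eq s1 (iota (size s2) (size s1)).
  by rewrite -E1 perm_sym; exact: permEl (perm_sort _ _).
pose s1' := [seq i - size s2 | i <- s1].
have Es1 : s1 = [seq size s2 + i | i <- s1'].
  rewrite -map_comp -[LHS]map_id; apply/eq_in_map => x /=.
  by rewrite (perm_mem P1) mem_iota => /andP[+ _]; move/subnKC.
have P1' : perm_eq s1' (iota 0 (size s1)).
  move: P1 => /(perm_map (subn^~ (size s2))).
  rewrite -[in iota _ _](addn0 (size s2)) iotaDl -map_comp.
  suff -> : [seq (subn^~ (size s2) \o addn (size s2)) i | i <- iota 0 (size s1)] = iota 0 (size s1) by [].
  rewrite -[RHS]map_id; apply: eq_map => x /=; by rewrite addKn.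
have A1 : avoids132 s1'.
  apply/(avoids132_shift (size s2)); rewrite -Es1.
  by apply: avoids132_subseq As; exact: prefix_subseq.
have A2 : avoids132 s2.
  apply: avoids132_subseq As; apply: subseq_trans (suffix_subseq s1 _).
  exact: subseq_cons.
have [|l El] := IH (size s1) _ _ P1' A1; first lia.
have [|r Er] := IH (size s2) _ _ P2 A2; first lia.
exists (Node l r) => /=.
have Nr : nodes r = size s2 by rewrite -size_word Er.
have Nl : nodes l = size s1 by rewrite -size_word El size_map.
by rewrite El Er Nr -Es1 Nl addnC.
Qed.

(** Enumeration by height at most [h], with [Leaf] of height 0. Height rather than node count makes
    the recursion a plain product; the trees with [n] nodes are all present once [n <= h]. *)
Fixpoint trees (h : nat) : seq tree :=
  if h is h'.+1 then
    Leaf :: [seq Node l r | l <- trees h', r <- trees h']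
  else [:: Leaf].

Lemma trees_uniq h : uniq (trees h).
Proof.
elim: h => //= h IH; rewrite allpairs_uniq ?andbT //; last first.
  by move=> [l r] [l' r'] _ _ [-> ->].
by apply/allpairsP => -[[l r] [_ _]].
Qed.

Lemma mem_trees h t : nodes t <= h -> t \in trees h.
Proof.
elim: h t => [|h IH] [|l r] //= H.
by rewrite inE /=; apply: allpairs_f; apply: IH; lia.
Qed.

Lemma sum_trees_height (V : nmodType) n h h' (F : tree -> V) : n <= h -> n <= h' ->
  (\sum_(t <- trees h | nodes t == n) F t = \sum_(t <- trees h' | nodes t == n) F t)%R.
Proof.
move=> Hh Hh'; rewrite -!(big_filter _ (fun t => nodes t == n)).
apply: perm_big; apply: uniq_perm; rewrite ?filter_uniq ?trees_uniq // => t.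
by rewrite !mem_filter; apply: andb_id2l => /eqP E; rewrite !mem_trees ?E.
Qed.

(** * Avoiding permutations in one-line notation and their bijection with trees *)

Definition oneline n (sigma : 'S_n) : seq nat :=
  [seq nat_of_ord (sigma i) | i <- enum 'I_n].

Lemma sorted_enum_ord n : sorted ltn [seq nat_of_ord i | i <- enum 'I_n].
Proof. by rewrite val_enum_ord iota_ltn_sorted. Qed.

Lemma tau132E (a b : 'I_3) : (tau132 a < tau132 b) = (nth 0 [:: 0; 2; 1] a < nth 0 [:: 0; 2; 1] b).
Proof.
have T i : nat_of_ord (tau132 i) = nth 0 [:: 0; 2; 1] i.
  rewrite /tau132; case: tpermP => [->|->|].
  - by rewrite !inordK.
  - by rewrite !inordK.
  case: i => [[|[|[|?]]]] //= H N1 N2; first by case: N1; apply: val_inj; rewrite /= inordK.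
  by case: N2; apply: val_inj; rewrite /= inordK.
by rewrite !T.
Qed.

Lemma containsP n (sigma : 'S_n) :
  reflect (exists i j k : 'I_n, [&& i < j, j < k & sigma i < sigma k < sigma j])
          (contains tau132 sigma).
Proof.
apply: (iffP existsP) => [[f /andP[/forallP H1 /forallP H2]]|].
  have inc a b : a < b < 3 -> f (inord a) < f (inord b).
    move=> ab; have /forallP/(_ (inord b))/implyP := H1 (inord a).
    by rewrite !inordK; [apply|..]; lia.
  exists (f (inord 0)), (f (inord 1)), (f (inord 2)).
  rewrite !inc //=.
  have /forallP/(_ (inord 2))/eqP := H2 (inord 0); rewrite tau132E !inordK //= => ->.
  by have /forallP/(_ (inord 1))/eqP := H2 (inord 2); rewrite tau132E !inordK //= => ->.
move=> [i [j [k /and4P[ij jk ik kj]]]].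
exists [ffun a : 'I_3 => nth i [:: i; j; k] a].
apply/andP; split; apply/forallP => a; apply/forallP => b; rewrite !ffunE.
  case: a b => [[|[|[|?]]] ?] [[|[|[|?]]] ?] //=; apply/implyP => //; lia.
rewrite tau132E; apply/eqP.
by case: a b => [[|[|[|?]]] ?] [[|[|[|?]]] ?] //=; lia.
Qed.

Lemma avoidersP n (sigma : 'S_n) :
  reflect (avoids132 (oneline sigma)) (sigma \in avoiders tau132 n).
Proof.
rewrite inE; apply: (iffP idP) => [/containsP H a b c|H].
  move=> /subseqP[m _]; rewrite /oneline -map_mask.
  have S := mask_subseq m (enum 'I_n).
  case E: (mask m (enum 'I_n)) S => [|i [|j [|k []]]] //= S [-> -> ->].
  apply/negP => /andP[ik kj]; apply: H; exists i, j, k.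
  have := subseq_sorted ltn_trans (map_subseq val S) (sorted_enum_ord n).
  by rewrite /= andbT => /andP[-> ->]; rewrite ik kj.
apply/containsP => -[i [j [k /and4P[ij jk ik kj]]]].
have S : subseq [:: i; j; k] (enum 'I_n).
  (* It remains to identify [[:: i; j; k]] with a filtering of the enumeration: both are strictly
     increasing with the same members. *)
  apply/(subseq_uniqP (enum_uniq 'I_n)).
  have inj := val_inj : injective (@nat_of_ord n).
  apply: (inj_map inj).
  apply: (irr_sorted_eq ltn_trans ltnn); first by rewrite /= ij jk.
  - by apply: subseq_sorted (map_subseq _ (filter_subseq _ _)) (sorted_enum_ord n); exact: ltn_trans.
  - move=> x; apply/mapP/mapP => -[y Hy ->]; exists y => //.
      by rewrite mem_filter Hy mem_enum.
    by move: Hy; rewrite mem_filter => /andP[].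
by have := H _ _ _ (map_subseq (fun i => nat_of_ord (sigma i)) S); rewrite ik kj.
Qed.

Lemma oneline_inj n : injective (@oneline n).
Proof.
move=> s1 s2 /eq_in_map E; apply/permP => i; apply: val_inj.
by apply: E; rewrite mem_enum.
Qed.

Lemma perm_oneline n (sigma : 'S_n) : perm_eq (oneline sigma) (iota 0 n).
Proof.
rewrite /oneline -val_enum_ord (map_comp val sigma); apply: perm_map.
apply: uniq_perm; rewrite ?(map_inj_uniq perm_inj) ?enum_uniq // => i.
rewrite mem_enum; apply/mapP; exists (sigma^-1%g i); rewrite ?mem_enum //.
by rewrite permKV.
Qed.

Lemma oneline_surj n s : perm_eq s (iota 0 n) -> exists sigma : 'S_n, oneline sigma = s.
Proof.
move=> P; have Ss : size s = n by rewrite (perm_size P) size_iota.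
have lt (i : 'I_n) : nth 0 s i < n.
  have : nth 0 s i \in iota 0 n by rewrite -(perm_mem P) mem_nth // Ss.
  by rewrite mem_iota.
have inj : injective (fun i => Ordinal (lt i)).
  move=> i j [/eqP]; rewrite nth_uniq ?Ss ?(perm_uniq P) ?iota_uniq // => /eqP.
  exact: val_inj.
exists (perm inj); apply: (@eq_from_nth _ 0).
  by rewrite size_map size_enum_ord Ss.
move=> i; rewrite size_map size_enum_ord => Hi.
by rewrite (nth_map (Ordinal Hi)) ?size_enum_ord // permE /= nth_enum_ord.
Qed.

(** The bijection between avoiders and trees, stated on words: both lists are duplicate-free, and
    [word_avoids132] and [avoids132_word] give the two inclusions. *)
Lemma perm_avoiders n :
  perm_eq [seq oneline sigma | sigma <- enum (avoiders tau132 n)]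
          [seq word t | t <- [seq t <- trees n | nodes t == n]].
Proof.
apply: uniq_perm.
- by rewrite (map_inj_uniq (@oneline_inj n)) enum_uniq.
- by rewrite (map_inj_uniq word_inj) filter_uniq ?trees_uniq.
move=> s; apply/mapP/mapP => -[].
  move=> sigma; rewrite mem_enum => /avoidersP A ->.
  have [t Et] := avoids132_word (perm_oneline sigma) A.
  have Nt : nodes t = n.
    by rewrite -size_word Et (perm_size (perm_oneline _)) size_iota.
  by exists t; rewrite // mem_filter Nt eqxx mem_trees ?Nt.
move=> t; rewrite mem_filter => /andP[/eqP Nt _] ->.
have [|sigma E] := @oneline_surj n (word t); first by rewrite -Nt perm_word.
exists sigma; rewrite // mem_enum; apply/avoidersP; rewrite E.
exact: word_avoids132.
Qed.

Lemma sum_avoiders (V : nmodType) n (F : seq nat -> V) :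
  (\sum_(sigma in avoiders tau132 n) F (oneline sigma) =
   \sum_(t <- trees n | nodes t == n) F (word t))%R.
Proof.
rewrite -big_enum /= -(big_map (@oneline n) xpredT F).
by rewrite (perm_big _ (perm_avoiders n)) /= big_map big_filter.
Qed.

(** * Longest subsequences *)

(** The up/down sequence is a prefix of the infinite word UUUDUUUD..., whose letters D sit at the
    indices congruent to 3. Unlike [repeats], this is stable under truncation. *)
Definition follows (u : seq nat) : Prop :=
  forall i, i.+1 < size u -> (nth 0 u i < nth 0 u i.+1) = (i %% 4 != 3).

(* The two functions give [best] of L m from [best] of L, and [best] of P R from
   those of P and R when all letters of P exceed those of R: a chain U...U cannot
   cross from P to R, so only complete blocks of P can be followed by R. *)
Definition extend_len (a : nat) : nat := if (0 < a) && (a %% 4 == 0) then a else a.+1.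

Definition concat_len (p b : nat) : nat := maxn p (4 * (p %/ 4) + b).

Fixpoint best (t : tree) : nat :=
  if t is Node l r then concat_len (extend_len (best l)) (best r) else 0.

Lemma follows_take j u : follows u -> follows (take j u).
Proof.
move=> G i; rewrite size_take_min => H.
rewrite !nth_take; try lia; apply: G; lia.
Qed.

Lemma follows_shift k u : follows [seq k + i | i <- u] <-> follows u.
Proof.
split=> G i; move: (G i); rewrite ?size_map => + H => /(_ H);
  by rewrite !(nth_map 0) ?ltn_add2l // ltnW.
Qed.

(** Appending a maximum creates a U at index [size u - 1], which is forbidden only when that index
    is congruent to 3. *)
Lemma follows_rcons (u : seq nat) m : all (gtn m) u -> follows u ->
  follows (rcons u m) <-> (size u == 0) || (size u %% 4 != 0).
Proof.
move=> /all_nthP lm G; split=> [G'|H i].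
  case: posnP => // u0; have pu : (size u).-1 < size u by lia.
  have := G' (size u).-1; rewrite size_rcons prednK // => /(_ (ltnSn _)).
  by rewrite !nth_rcons pu ltnn eqxx (lm 0 _ pu : nth 0 u _ < m); lia.
rewrite size_rcons => Hi; rewrite !nth_rcons.
case: (ltnP i.+1 (size u)) => Hi'.
  by rewrite (ltnW Hi'); apply: G.
have E : i.+1 = size u by lia.
rewrite -E ltnSn eqxx; have -> : nth 0 u i < m by apply: (lm 0); lia.
by move: H; rewrite -E; lia.
Qed.

(** The junction is a descent, so its index [size u - 1] must be congruent to 3; the pattern then
    restarts at the first letter of [v]. *)
Lemma follows_cat (u v : seq nat) : (forall x y, x \in u -> y \in v -> y < x) ->
  0 < size u -> 0 < size v ->
  follows (u ++ v) <-> [/\ follows u, follows v & size u %% 4 = 0].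
Proof.
move=> lt u0 v0; split=> [G|[Gu Gv H] i].
  have S4 : size u %% 4 = 0.
    have pu : (size u).-1 < size u by lia.
    have := G (size u).-1; rewrite size_cat prednK // !nth_cat ltnn subnn pu.
    rewrite [nth _ _ _ < _]ltnNge (ltnW (lt _ _ (mem_nth 0 pu) (mem_nth 0 v0))).
    rewrite -[X in X < _]addn0 ltn_add2l v0 => /(_ isT) /esym /negbFE /eqP; lia.
  split=> // i Hi.
    have := G i; rewrite size_cat !nth_cat Hi (ltnW Hi); apply; lia.
  have := G (size u + i); rewrite size_cat -addnS ltn_add2l !nth_cat.
  rewrite !ltnNge !leq_addr /= -!ltnNge !addKn => /(_ Hi) ->.
  by rewrite -modnDm S4 add0n modn_mod.
rewrite size_cat => Hi; rewrite !nth_cat.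
case: (ltnP i.+1 (size u)) => Hi'; first by rewrite (ltnW Hi'); apply: Gu.
case: (ltnP i (size u)) => Hi2.
  have -> : i.+1 - size u = 0 by lia.
  rewrite [nth _ _ _ < _]ltnNge (ltnW (lt _ _ (mem_nth 0 Hi2) (mem_nth 0 v0))); lia.
have -> : i.+1 - size u = (i - size u).+1 by lia.
by rewrite Gv; lia.
Qed.

Lemma best_max t u : follows u -> subseq u (word t) -> size u <= best t.
Proof.
elim: t u => [|l IHl r IHr] u G; first by move=> /= /eqP ->.
rewrite [word _]/= => /subseq_cat_split[u1 [u23 [E S1 S23]]].
have {S23} [u2 [u3 [E' S2 S3]]] := @subseq_cat_split u23 [:: nodes l + nodes r] (word r) S23.
rewrite {u23}E' catA in E.
have lt1 x : x \in u1 -> nodes r <= x < nodes l + nodes r.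
  by move=> /(mem_subseq S1) /mapP[y]; rewrite mem_word => ? ->; lia.
have lt3 x : x \in u3 -> x < nodes r.
  by move=> /(mem_subseq S3); rewrite mem_word.
have eq2 x : x \in u2 -> x = nodes l + nodes r.
  by move=> /(mem_subseq S2); rewrite inE => /eqP.
have G12 : follows (u1 ++ u2).
  by rewrite -(take_size_cat u3 (erefl (size (u1 ++ u2)))) -E; apply: follows_take.
have G1 : follows u1.
  by rewrite -(take_size_cat u2 (erefl (size u1))); apply: follows_take.
have le1 : size u1 <= best l.
  have [m _ Em] := subseqP S1.
  move: G1; rewrite {1}Em -map_mask follows_shift => G1.
  by rewrite Em -map_mask size_map; apply: IHl => //; exact: mask_subseq.
(* When [best l] is a positive multiple of 4, a [u1] of that length cannot take the maximum, and a
   shorter one gains at most what it lacked. *)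
have le12 : size (u1 ++ u2) <= extend_len (best l).
  case: u2 S2 eq2 G12 {E} => [|x [|y u2]] S2 eq2 G12.
  - by rewrite cats0 /extend_len; case: ifP; lia.
  - move: G12; rewrite cats1 (eq2 x) ?inE // => /follows_rcons.
    have -> : all (gtn (nodes l + nodes r)) u1.
      by apply/allP => y /lt1 /andP[].
    by move=> /(_ isT G1); rewrite size_rcons /extend_len; case: ifP; lia.
  - by have := size_subseq S2.
rewrite E size_cat /= /concat_len.
case: (posnP (size u3)) => [->|u30]; first lia.
(* With nothing before [u3] there is no junction, and [u] is [u3] itself. Otherwise the length
   before [u3] is a multiple of 4, hence at most 4 times the quotient in [concat_len]. *)
case: (posnP (size (u1 ++ u2))) => [u0|u0].
  have := IHr u3; rewrite S3.
  have -> : u3 = u by rewrite E (size0nil u0).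
  by move=> /(_ G isT); rewrite u0; lia.
have lt x y : x \in u1 ++ u2 -> y \in u3 -> y < x.
  by rewrite mem_cat => /orP[/lt1|/eq2] H /lt3; lia.
rewrite E in G; have [_ G3 H4] := (follows_cat lt u0 u30).1 G.
by have := IHr _ G3 S3; lia.
Qed.

Lemma best_attained t : exists u, [/\ follows u, subseq u (word t) & size u = best t].
Proof.
elim: t => [|l [ul [Gl Sl El]] r [ur [Gr Sr Er]]]; first by exists [::].
pose v := [seq nodes r + i | i <- ul]; pose m := nodes l + nodes r.
have Gv : follows v by apply/follows_shift.
have ltv : all (gtn m) v.
  apply/allP => x /mapP[y /(mem_subseq Sl)]; rewrite mem_word /m => ? -> /=.
  by rewrite addnC ltn_add2r.
pose p := if (0 < best l) && (best l %% 4 == 0) then v else rcons v m.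
have Sp : size p = extend_len (best l).
  by rewrite /p /extend_len; case: ifP; rewrite ?size_rcons size_map El.
have Gp : follows p.
  rewrite /p; case: ifPn => // H; apply/follows_rcons => //.
  by rewrite size_map El; lia.
have sub : subseq p ([seq nodes r + i | i <- word l] ++ [:: m]).
  rewrite /p; case: ifP => _; last by rewrite -cats1 cat_subseq ?map_subseq.
  by apply: subseq_trans (map_subseq _ Sl) _; exact: prefix_subseq.
have W : word (Node l r) = ([seq nodes r + i | i <- word l] ++ [:: m]) ++ word r.
  by rewrite -catA.
have [b|b] := leqP (4 * (extend_len (best l) %/ 4) + best r) (extend_len (best l)).
  exists p; split=> //; last by rewrite Sp /= /concat_len; lia.
  by rewrite W; apply: subseq_trans sub _; exact: prefix_subseq.
have r0 : 0 < size ur by rewrite Er; lia.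
(* Cutting [p] back to its complete blocks of 4 letters makes the descent into the right block fall
   on a D. *)
exists (take (4 * (extend_len (best l) %/ 4)) p ++ ur); split; last 1 first.
- by rewrite size_cat size_take_min Sp Er /= /concat_len; lia.
- case: (posnP (size (take (4 * (extend_len (best l) %/ 4)) p))) => [/size0nil ->|t0] //.
  apply/follows_cat => //; last first.
    by split; [exact: follows_take|by []|rewrite size_take_min Sp; lia].
  move=> x y /mem_take /(mem_subseq sub); rewrite mem_cat inE => xl.
  move=> /(mem_subseq Sr); rewrite mem_word => yr.
  by case/orP: xl => [/mapP[z _ ->]|/eqP ->]; rewrite /m; lia.
- rewrite W; apply: cat_subseq => //; apply: subseq_trans sub; exact: take_subseq.
Qed.

(** The [k]-fold repetition is the prefix of length [4 * k] of the infinite pattern, so only the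
    length distinguishes [repeats] from [follows]. *)
Lemma repeatsP u :
  repeats [:: true; true; true; false] u <->
  follows u /\ exists2 k, 0 < k & size u = 4 * k + 1.
Proof.
have nthW k i : i < 4 * k ->
    nth true (flatten (nseq k [:: true; true; true; false])) i = (i %% 4 != 3).
  elim: k i => [|k IH] i; first lia.
  move=> H; rewrite /= ; case: i H => [|[|[|[|i]]]] //= H.
  by rewrite IH; lia.
have sizeW k : size (flatten (nseq k [:: true; true; true; false])) = 4 * k.
  by rewrite size_flatten /shape map_nseq sumn_nseq mulnC.
have nthV v i : i.+1 < size v -> nth true (updown v) i = (nth 0 v i < nth 0 v i.+1).
  by case: v => // x v; rewrite /= ltnS => H; rewrite (nth_pairmap 0).
have sizeV v : size (updown v) = (size v).-1.
  by case: v => //= x v; rewrite size_pairmap.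
split=> [[k k0 E]|[G [k k0 E]]].
  have Su : size u = 4 * k + 1.
    by have := congr1 size E; rewrite sizeV sizeW; lia.
  split; last by exists k.
  by move=> i Hi; rewrite -nthV // E nthW //; lia.
exists k => //; apply: (@eq_from_nth _ true).
  by rewrite sizeV sizeW E; lia.
move=> i; rewrite sizeV E => Hi; rewrite nthV ?nthW; try lia.
by apply: G; lia.
Qed.

Lemma subword_subseq n (sigma : 'S_n) A : subseq (subword sigma A) (oneline sigma).
Proof. by apply: map_subseq; rewrite {1}/enum_mem -enumT; exact: filter_subseq. Qed.

Lemma subseq_subword n (sigma : 'S_n) u : subseq u (oneline sigma) ->
  exists2 A, subword sigma A = u & #|A| = size u.
Proof.
move=> /subseqP[m _ ->]; rewrite -map_mask.
have S := mask_subseq m (enum 'I_n).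
exists [set i in mask m (enum 'I_n)].
  rewrite /subword; congr map; rewrite {1}/enum_mem -enumT.
  rewrite [RHS](subseq_uniqP (enum_uniq 'I_n) S); apply: eq_filter => i.
  by rewrite /= inE.
by rewrite size_map cardsE; apply/card_uniqP; rewrite mask_uniq // enum_uniq.
Qed.

Lemma longest_repeating_best n (sigma : 'S_n) t : oneline sigma = word t ->
  best t <= longest_repeating [:: true; true; true; false] sigma + 4 /\
  longest_repeating [:: true; true; true; false] sigma <= best t.
Proof.
move=> E; split; last first.
  apply/bigmax_leqP => A /asboolP /repeatsP[G _].
  rewrite cardE -(size_map (fun i => nat_of_ord (sigma i))).
  by apply: best_max G _; rewrite -E; exact: subword_subseq.
(* Fewer than 5 letters hold no complete pattern, and the slack 4 absorbs them. Otherwise an optimal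
   sequence is truncated to the largest length [4 * k + 1] that fits, losing at most 3. *)
have [|le5] := ltnP (best t) 5; first lia.
have [u [G S Su]] := best_attained t.
pose k := (best t - 1) %/ 4.
have [|A EA cA] := @subseq_subword n sigma (take (4 * k + 1) u).
  by rewrite E; apply: subseq_trans S; exact: take_subseq.
rewrite size_take_min Su in cA.
suff : #|A| <= longest_repeating [:: true; true; true; false] sigma by lia.
apply: (@leq_bigmax_cond _ _ (fun A : {set 'I_n} => #|A|)).
apply/asboolP/repeatsP; rewrite EA; split; first exact: follows_take.
by exists k; [|rewrite size_take_min Su]; lia.
Qed.

(** * Counting nodes by their left subtree *)

Definition catalan (n : nat) : nat := \sum_(t <- trees n | nodes t == n) 1.

Lemma sum_trees0 (F : tree -> nat) :
  \sum_(t <- trees 0 | nodes t == 0) F t = F Leaf.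
Proof. by rewrite big_cons big_nil addn0. Qed.

Lemma sum_treesS m (F : tree -> nat) :
  \sum_(t <- trees m.+1 | nodes t == m.+1) F t =
  \sum_(i < m.+1) \sum_(l <- trees i | nodes l == i)
    \sum_(r <- trees (m - i) | nodes r == m - i) F (Node l r).
Proof.
transitivity (\sum_(i < m.+1) \sum_(l <- trees m | nodes l == i)
    \sum_(r <- trees m | nodes r == m - i) F (Node l r)); last first.
  apply: eq_bigr => i _; rewrite (sum_trees_height (h' := i)) //; last by have := ltn_ord i.
  by apply: eq_bigr => l _; rewrite (sum_trees_height (h' := m - i)) // leq_subr.
rewrite /= big_cons /= big_mkcond big_allpairs_dep /=.
under [RHS]eq_bigr do rewrite big_mkcond.
rewrite [RHS]exchange_big; apply: eq_bigr => l _ /=.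
have [lm|ml] := leqP (nodes l) m.
  rewrite (bigD1 (Ordinal (lm : nodes l < m.+1))) //= eqxx [X in _ + X]big1 ?addn0.
    rewrite [RHS]big_mkcond; apply: eq_bigr => r _.
    by case: eqP; case: eqP => //; lia.
  by move=> i /eqP ne; case: eqP => // E; case: ne; apply: val_inj.
rewrite !big1 // => [i _|r _]; last by case: eqP => //; lia.
by case: eqP => // E; have := ltn_ord i; lia.
Qed.

Lemma catalan0 : catalan 0 = 1.
Proof. exact: sum_trees0. Qed.

Lemma catalanS m : catalan m.+1 = \sum_(i < m.+1) catalan i * catalan (m - i).
Proof.
rewrite /catalan sum_treesS; apply: eq_bigr => i _.
by rewrite big_distrl /=; apply: eq_bigr => l _; rewrite mul1n.
Qed.

(* Adding to the sum its reversal i |-> m - i makes the weight i constant. *)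
Lemma sym_convolution m (f : nat -> nat) :
  2 * (\sum_(i < m.+1) i * (f i * f (m - i))) = m * (\sum_(i < m.+1) f i * f (m - i)).
Proof.
rewrite mul2n -addnn {2}(reindex_inj rev_ord_inj) /= -big_split big_distrr /=.
apply: eq_bigr => i _; have im : i <= m by rewrite -ltnS.
by rewrite subSS subKn // [f (m - i) * _]mulnC -mulnDl subnKC.
Qed.

(** This evaluates the convolution of the numbers [(2 * i + 1) * catalan i] with the Catalan
    numbers, which solves the recursion of [sum_occurrences] and also drives the induction in
    [catalan_rec]. *)
Lemma catalan_weighted m :
  \sum_(i < m) (2 * i + 1) * (catalan i * catalan (m - i.+1)) = m * catalan m.
Proof.
case: m => [|m]; first by rewrite big_ord0.
rewrite mulSn addnC catalanS -sym_convolution big_distrr -big_split /=.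
by apply: eq_bigr => i _; rewrite subSS mulnDl mul1n -mulnA.
Qed.

(** The sum of [i.+1 * (catalan i * catalan (n - i))] is computed twice: by the induction hypothesis
    with [catalan_weighted], and by symmetry with [sym_convolution]. *)
Lemma catalan_rec n : n.+2 * catalan n.+1 = 2 * (2 * n + 1) * catalan n.
Proof.
elim/ltn_ind: n => n IH.
have : \sum_(i < n.+1) i.+1 * (catalan i * catalan (n - i)) = (2 * n + 1) * catalan n.
  rewrite big_ord_recl /= mul1n catalan0 mul1n subn0 mulnDl mul1n -mulnA.
  rewrite addnC -catalan_weighted big_distrr; congr (_ + _).
  apply: eq_bigr => i _ /=; rewrite /bump /= add1n mulnA IH //; lia.
under eq_bigr do rewrite mulSn.
rewrite big_split /= -catalanS => H.
have := sym_convolution n catalan; rewrite -catalanS.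
move: H; move: (catalan n) (catalan n.+1) (\sum_(i < _) _) => c c' S. by nia.
Qed.

Fixpoint occurrences (u t : tree) : nat :=
  if t is Node l r then occurrences u l + occurrences u r + (l == u) else 0.

Lemma sum_eq_tree n u : \sum_(t <- trees n | nodes t == n) (t == u : nat) = (nodes u == n).
Proof.
pose s := [seq t <- trees n | nodes t == n].
rewrite -(big_filter _ (fun t => nodes t == n)) -/s.
have us : (u \in s) = (nodes u == n).
  by rewrite mem_filter; case: eqP => //= E; rewrite mem_trees ?E.
case: (boolP (u \in s)) => H.
  rewrite (bigD1_seq u) ?filter_uniq ?trees_uniq //= eqxx -us H big1 // => t.
  by move=> /negPf ->.
rewrite -us (negPf H) big1_seq // => t /andP[_ ts].
by case: eqP ts H => // -> ->.
Qed.

(** Cutting at the root, the two subtrees contribute equal convolutions, and the root itself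
    contributes the number of possible right subtrees when the left one is [u]. The solution depends
    on [u] only through its size. *)
Lemma sum_occurrences u n :
  \sum_(t <- trees n | nodes t == n) occurrences u t =
  if nodes u < n then (2 * (n - (nodes u).+1) + 1) * catalan (n - (nodes u).+1) else 0.
Proof.
pose g n := \sum_(t <- trees n | nodes t == n) occurrences u t.
have g0 : g 0 = 0 by rewrite /g sum_trees0.
have gS m : g m.+1 = 2 * (\sum_(i < m.+1) g i * catalan (m - i))
    + (if nodes u <= m then catalan (m - nodes u) else 0).
  rewrite mul2n -addnn {2}(reindex_inj rev_ord_inj) /=.
  rewrite {1}/g sum_treesS.
  transitivity (\sum_(i < m.+1) (g i * catalan (m - i) + g (m - i) * catalan i
      + (nodes u == i) * catalan (m - i))).
    apply: eq_bigr => i _.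
    transitivity (\sum_(l <- trees i | nodes l == i)
       (occurrences u l * catalan (m - i) + g (m - i) + (l == u) * catalan (m - i))).
      apply: eq_bigr => l _; rewrite /= !big_split /=; congr (_ + _ + _).
        by rewrite /catalan big_distrr /=; apply: eq_bigr => *; rewrite muln1.
      by rewrite /catalan big_distrr /=; apply: eq_bigr => *; rewrite muln1.
    rewrite !big_split /= -!big_distrl /= sum_eq_tree; congr (_ + _ + _).
    by rewrite /catalan big_distrr /=; apply: eq_bigr => *; rewrite muln1.
  rewrite !big_split /=; congr (_ + _ + _).
    apply: eq_bigr => i _; rewrite subSS subKn // -ltnS //.
  case: leqP => [um|mu].
    rewrite (bigD1 (Ordinal (um : nodes u < m.+1))) //= eqxx mul1n big1 ?addn0 //.
    by move=> i /eqP ne; case: eqP => // E; case: ne; apply: val_inj.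
  by rewrite big1 // => i _; have := ltn_ord i; case: eqP => //; lia.
elim/ltn_ind: n => -[|m] IH; first by rewrite -/(g 0) g0.
rewrite -/(g _) gS ltnS; case: leqP => [um|mu]; last first.
  rewrite addn0 big1 ?muln0 // => i _.
  by rewrite /g IH //; case: ltnP; rewrite ?mul0n //; have := ltn_ord i; lia.
rewrite subSS; move: (m - nodes u) (subnKC um) => q Em.
rewrite mulnDl mul1n -mulnA; congr (2 * _ + _).
rewrite -catalan_weighted -(big_mkord xpredT (fun i => g i * catalan (m - i))).
(* The terms with [i <= nodes u] vanish; shifted by [(nodes u).+1], the others form the sum of
   [catalan_weighted]. *)
rewrite (big_cat_nat _ (n := (nodes u).+1)) //=.
rewrite big_nat big1 ?add0n; last first.
  move=> i /andP[_ iu]; rewrite /g IH; last by lia.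
  by case: ltnP; rewrite ?mul0n //; lia.
rewrite -{1}(add0n (nodes u).+1) big_addn -(big_mkord xpredT
   (fun i => (2 * i + 1) * (catalan i * catalan (q - i.+1)))).
have -> : m.+1 - (nodes u).+1 = q by lia.
rewrite !big_nat; apply: eq_bigr => i /andP[_ iq].
rewrite /g IH; last by lia.
have -> : nodes u < i + (nodes u).+1 by lia.
by rewrite addnK mulnA; congr (_ * catalan _); lia.
Qed.

Definition left_count (P : pred tree) :=
  fix count (t : tree) : nat :=
  if t is Node l r then count l + count r + P l else 0.

Lemma left_count_C P t : left_count P t + left_count (predC P) t = nodes t.
Proof. by elim: t => //= l <- r <-; case: (P l) => /=; lia. Qed.

(** Each node is counted at most once because [s] has no duplicates; nodes whose left subtree is
    missing from [s] are lost, hence only an inequality. *)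
Lemma occurrences_left_count (P : pred tree) s t : uniq s ->
  \sum_(u <- s | P u) occurrences u t <= left_count P t.
Proof.
move=> Us; elim: t => [|l IHl r IHr] /=; first by rewrite big1.
rewrite !big_split /= !leq_add //.
case: (boolP (l \in s)) => H; last first.
  by rewrite big1_seq // => u /andP[_ us]; case: eqP us H => // -> ->.
rewrite big_mkcond (bigD1_seq l) //= big1 ?addn0; first by case: (P l); rewrite ?eqxx.
by move=> u; rewrite eq_sym => /negPf ->; case: ifP.
Qed.

(** The number of complete blocks is additive under [concat_len], and [extend_len] completes a new
    block exactly from residue 3. *)
Lemma best_div4 t : best t %/ 4 = left_count (fun u => best u %% 4 == 3) t.
Proof.
elim: t => //= l <- r <-; rewrite /concat_len /extend_len.
move: (best l) (best r) => a b.
have H p : maxn p (4 * (p %/ 4) + b) %/ 4 = p %/ 4 + b %/ 4 by lia.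
by rewrite H; case: ifP => [/andP[? /eqP ?]|/negbT ?]; case: eqP => /=; lia.
Qed.

Local Open Scope classical_set_scope.
Local Open Scope ring_scope.

(** * Total weight of the trees in each state *)

(* Only [best %% 4] and its exact value below 4 influence the recursion: 0..3 stand
   for themselves and 4 + c for the values >= 4 congruent to c modulo 4. *)
Definition reduce (a : nat) : nat := if (a < 8)%N then a else (4 + a %% 4)%N.
Definition state (t : tree) : nat := reduce (best t).
Definition next_state (a b : nat) : nat := reduce (concat_len (extend_len a) b).

(** After reduction, [concat_len] sees its first argument only through its residue and whether it is
    below 4; the same data let [extend_len] tell 0 from the positive multiples of 4. *)
Lemma state_Node l r : state (Node l r) = next_state (state l) (state r).
Proof.
rewrite /state /next_state /= /concat_len /extend_len /reduce.
move: (best l) (best r) => a b.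
have H p p' : (p %% 4 = p' %% 4 -> (p < 4) = (p' < 4) ->
  reduce (maxn p (4 * (p %/ 4) + b)) = reduce (maxn p' (4 * (p' %/ 4) + reduce b)))%N.
  by rewrite /reduce => E1 E2; do ! case: ifP; lia.
apply: H; case: (ltnP a 8) => a8 //; do ! case: ifP; lia.
Qed.

Lemma state_lt8 t : (state t < 8)%N.
Proof. by rewrite /state /reduce; case: ifP; lia. Qed.

Lemma state_mod4 t : (state t %% 4 = best t %% 4)%N.
Proof. by rewrite /state /reduce; case: ifP; lia. Qed.

(** A computable list, so that the equations for the limit weights can be expanded by evaluation. *)
Definition state_preimage (s : nat) : seq (nat * nat) :=
  [seq p <- [seq (a, b) | a <- iota 0 8, b <- iota 0 8] | next_state p.1 p.2 == s].

Section Weights.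
Variable R : realType.

(** The generating function of the trees in state [s], truncated at height [h] and evaluated at 1/4,
    the radius of convergence of the Catalan series. *)
Definition weight (h s : nat) : R :=
  \sum_(t <- trees h | state t == s) 4^-1 ^+ nodes t.

Lemma weight_ge0 h s : 0 <= weight h s.
Proof. by apply: sumr_ge0 => t _; apply: exprn_ge0; rewrite invr_ge0. Qed.

Lemma sum_by_state h (F : nat -> R) :
  \sum_(t <- trees h) F (state t) * 4^-1 ^+ nodes t =
  \sum_(a <- iota 0 8) F a * weight h a.
Proof.
under [RHS]eq_bigr do rewrite /weight big_mkcond big_distrr.
rewrite [RHS]exchange_big; apply: eq_bigr => t _ /=.
have st : state t \in iota 0 8 by rewrite mem_iota state_lt8.
rewrite (bigD1_seq _ st (iota_uniq 0 8)) /= eqxx.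
rewrite big1 ?addr0 // => a; rewrite eq_sym => /negPf ->; exact: mulr0.
Qed.

Lemma weight0 s : weight 0 s = (s == 0%N)%:R.
Proof. by rewrite /weight big_mkcond big_cons big_nil /= addr0 eq_sym; case: eqP. Qed.

Lemma weightS h s :
  weight h.+1 s = (s == 0%N)%:R
    + 4^-1 * \sum_(p <- state_preimage s) weight h p.1 * weight h p.2.
Proof.
rewrite /weight big_mkcond big_cons big_allpairs_dep /=; congr (_ + _).
  by rewrite eq_sym; case: eqP.
rewrite /state_preimage big_filter [in RHS]big_mkcond [in RHS]big_allpairs_dep big_distrr.
transitivity (\sum_(l <- trees h) (4^-1 * \sum_(b <- iota 0 8)
    (next_state (state l) b == s)%:R * weight h b) * 4^-1 ^+ nodes l).
  apply: eq_bigr => l _.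
  rewrite -(sum_by_state h (fun b => (next_state (state l) b == s)%:R)).
  rewrite big_distrr big_distrl; apply: eq_bigr => r _ /=.
  rewrite state_Node exprS exprD; case: ifP => _ /=; ring.
rewrite (sum_by_state h (fun a => 4^-1 * \sum_(b <- iota 0 8)
   (next_state a b == s)%:R * weight h b)).
apply: eq_bigr => a _; rewrite -mulrA; congr (_ * _).
rewrite big_distrl; apply: eq_bigr => b _ /=.
by case: ifP => _; rewrite ?mul1r ?mul0r // mulrC.
Qed.

Lemma weight_nondecreasing s : nondecreasing_seq (weight ^~ s).
Proof.
apply/nondecreasing_seqP => h; elim: h s => [|h IH] s.
  rewrite weight0 weightS lerDl mulr_ge0 ?invr_ge0 //.
  by apply: sumr_ge0 => p _; rewrite mulr_ge0 // weight_ge0.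
rewrite !weightS lerD2l ler_wpM2l ?invr_ge0 //.
by apply: ler_sum => p _; rewrite ler_pM ?weight_ge0.
Qed.

(** The total at height [h.+1] is [1 + z * z / 4] for the total [z] at height [h], and 2 is a fixed
    point of this increasing map. *)
Lemma total_weight_le2 h : \sum_(t <- trees h) 4^-1 ^+ nodes t <= 2 :> R.
Proof.
elim: h => [|h IH]; first by rewrite big_cons big_nil addr0 expr0 ler1n.
rewrite big_cons big_allpairs_dep /= expr0.
set z := \sum_(t <- _) _ in IH.
have -> : \sum_(l <- trees h) \sum_(r <- trees h) 4^-1 ^+ (nodes l + nodes r).+1
    = 4^-1 * (z * z) :> R.
  rewrite /z big_distrl big_distrr; apply: eq_bigr => l _.
  rewrite !big_distrr; apply: eq_bigr => r _ /=.
  by rewrite exprS exprD.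
have z0 : 0 <= z by apply: sumr_ge0 => t _; apply: exprn_ge0; rewrite invr_ge0.
nra.
Qed.

Lemma weight_le2 h s : weight h s <= 2.
Proof.
apply: le_trans (total_weight_le2 h); rewrite /weight big_mkcond.
by apply: ler_sum => t _; case: ifP => // _; apply: exprn_ge0; rewrite invr_ge0.
Qed.

Definition limit_weight (s : nat) : R := limn (weight ^~ s).

Lemma cvg_weight s : weight ^~ s @ \oo --> limit_weight s.
Proof.
apply: nondecreasing_is_cvgn; first exact: weight_nondecreasing.
by exists 2 => _ [h _ <-]; exact: weight_le2.
Qed.

Lemma cvg_big_sum (I : Type) (r : seq I) (P : pred I) (f : I -> nat -> R) (l : I -> R) :
  (forall i, P i -> f i @ \oo --> l i) ->
  (fun n => \sum_(i <- r | P i) f i n) @ \oo --> \sum_(i <- r | P i) l i.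
Proof.
move=> H; elim: r => [|i r IH].
  by under eq_fun do rewrite big_nil; rewrite big_nil; exact: cvg_cst.
under eq_fun do rewrite big_cons; rewrite big_cons.
by case: ifP => // /H Hi; exact: cvgD.
Qed.

Lemma limit_weight_eq s :
  limit_weight s = (s == 0%N)%:R
    + 4^-1 * \sum_(p <- state_preimage s) limit_weight p.1 * limit_weight p.2.
Proof.
apply: cvg_lim => //.
rewrite -cvg_shiftS; under eq_fun do rewrite weightS.
apply: cvgD; first exact: cvg_cst.
apply: cvgM; first exact: cvg_cst.
by apply: cvg_big_sum => p _; apply: cvgM; exact: cvg_weight.
Qed.

Lemma limit_weights :
  limit_weight 3 + limit_weight 7 = 2 / 11 /\
  limit_weight 0 + limit_weight 1 + limit_weight 2 + limit_weight 4
    + limit_weight 5 + limit_weight 6 = 20 / 11.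
Proof.
have := limit_weight_eq 0; have := limit_weight_eq 1; have := limit_weight_eq 2;
have := limit_weight_eq 3; have := limit_weight_eq 4; have := limit_weight_eq 5;
have := limit_weight_eq 6; have := limit_weight_eq 7.
do ! match goal with |- context [state_preimage ?k] =>
  let L := eval vm_compute in (state_preimage k) in change (state_preimage k) with L
end.
rewrite !big_cons !big_nil /= !add0r.
move: limit_weight => w E7 E6 E5 E4 E3 E2 E1 E0.
pose T := w 0%N + w 1%N + w 2%N + w 3%N + w 4%N + w 5%N + w 6%N + w 7%N.
(* Summing the eight equations: every pair of states has one image. *)
have ET : T = 1 + 4^-1 * (T * T).
  rewrite {1}/T {1}E7 {1}E6 {1}E5 {1}E4 {1}E3 {1}E2 {1}E1 {1}E0 /T; ring.
(* At 1/4 the quadratic has a double root, so no branch has to be chosen. *)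
have T2 : T = 2.
  have : (T - 2) ^+ 2 = 0 by rewrite expr2; lra.
  by move/eqP; rewrite sqrf_eq0 subr_eq0 => /eqP.
(* No pair produces state 0, since [extend_len] is positive. States 1 to 3 arise only from states up
   to themselves, so their equations are linear once solved in order. *)
have W0 : w 0%N = 1 by lra.
have W1 : w 1%N = 3^-1 by rewrite W0 in E1; lra.
have W2 : w 2%N = 6^-1 by rewrite W0 W1 in E2; lra.
have W3 : w 3%N = 10^-1 by rewrite W0 W1 W2 in E3; lra.
(* A right subtree in a state at least 4 imposes its residue whatever the left one is, which
   produces the factor [T]. Substituting [T = 2] makes the remaining system linear, closed by the
   equation for the total. *)
have F4 : w 4%N = 4^-1 * (T * w 4%N + (w 3%N + w 4%N + w 7%N) * w 0%N).
  by rewrite {1}E4 /T; ring.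
have F5 : w 5%N = 4^-1 * (T * w 5%N + (w 3%N + w 4%N + w 7%N) * w 1%N).
  by rewrite {1}E5 /T; ring.
have F6 : w 6%N = 4^-1 * (T * w 6%N + (w 3%N + w 4%N + w 7%N) * w 2%N
    + w 5%N * (w 0%N + w 1%N + w 2%N)).
  by rewrite {1}E6 /T; ring.
have : T = 2 by []; rewrite /T.
move: F4 F5 F6; rewrite T2 W0 W1 W2 W3 => F4 F5 F6 F7; split; lra.
Qed.

End Weights.

(** * Asymptotics *)

Section Asymptotics.
Variable R : realType.

Lemma catalan_gt0 n : (0 < catalan n)%N.
Proof.
elim: n => [|n IH]; first by rewrite catalan0.
by have := catalan_rec n; case: (catalan n.+1) => //; nia.
Qed.

Lemma cvg_catalan_ratio1 :
  (fun m => (catalan m)%:R / (catalan m.+1)%:R : R) @ \oo --> (4^-1 : R).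
Proof.
(* The ratio [(m + 2) / (2 * (2 * m + 1))] from [catalan_rec], with numerator and denominator
   divided by [m + 1]. *)
have -> : (fun m => (catalan m)%:R / (catalan m.+1)%:R : R) =
    (fun m => (1 + harmonic m) * (2 * (2 - harmonic m))^-1).
  apply/funext => m; rewrite /harmonic /=.
  have := congr1 (fun k => k%:R : R) (catalan_rec m).
  have c0 : (catalan m)%:R != 0 :> R by rewrite pnatr_eq0 -lt0n catalan_gt0.
  have c1 : (catalan m.+1)%:R != 0 :> R by rewrite pnatr_eq0 -lt0n catalan_gt0.
  rewrite !natrM natrD natrM -(natr1 m.+1) -(natr1 m).
  move: (catalan m)%:R (catalan m.+1)%:R c0 c1 => c c' c0 c1 E.
  have m0 : 0 <= m%:R :> R by [].
  have n1 : m%:R + 1 != 0 :> R by lra.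
  have n2 : 2 * m%:R + 1 != 0 :> R by lra.
  have n3 : 2 * (2 - (m%:R + 1)^-1) != 0 :> R.
    have -> : 2 * (2 - (m%:R + 1)^-1) = 2 * (2 * m%:R + 1) / (m%:R + 1) :> R by field.
    by rewrite !mulf_neq0 ?invr_neq0 // pnatr_eq0.
  apply/eqP; rewrite eqr_div //; apply/eqP.
  have -> : 1 + (m%:R + 1)^-1 = (m%:R + 1)^-1 * (m%:R + 1 + 1) :> R by field.
  rewrite -mulrA E; field.
  by [].
rewrite (_ : 4^-1 = (1 + 0) * (2 * (2 - 0))^-1); last by field.
apply: cvgM; first by apply: cvgD; [exact: cvg_cst|exact: cvg_harmonic].
apply: cvgV; first by rewrite subr0 mulf_neq0.
apply: cvgM; first exact: cvg_cst.
by apply: cvgB; [exact: cvg_cst|exact: cvg_harmonic].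
Qed.

Lemma cvg_catalan_ratio k :
  (fun m => (catalan m)%:R / (catalan (m + k))%:R : R) @ \oo --> (4^-1 ^+ k : R).
Proof.
elim: k => [|k IH].
  under eq_fun => m do
    rewrite addn0 divff ?pnatr_eq0 -?lt0n ?catalan_gt0 //.
  exact: cvg_cst.
have -> : (fun m => (catalan m)%:R / (catalan (m + k.+1))%:R : R) =
  (fun m => (catalan m)%:R / (catalan (m + k))%:R *
     ((catalan (m + k))%:R / (catalan (m + k).+1)%:R)).
  apply/funext => m; rewrite addnS mulrA divfK //.
  by rewrite pnatr_eq0 -lt0n catalan_gt0.
rewrite exprSr; apply: cvgM => //.
by rewrite (cvg_shiftn k (fun m => (catalan m)%:R / (catalan m.+1)%:R : R)) //; exact: cvg_catalan_ratio1.
Qed.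

(** The denominator is the total number of nodes of all trees with [n] nodes. *)
Definition density (F : tree -> nat) (n : nat) : R :=
  (\sum_(t <- trees n | nodes t == n) F t)%N%:R / (n%:R * (catalan n)%:R).

Lemma cvg_density_occurrences u :
  density (occurrences u) @ \oo --> (4^-1 ^+ nodes u / 2 : R).
Proof.
rewrite -(cvg_shiftn (nodes u).+1).
set k := nodes u.
(* With [n = m + k + 1], the factor [(2 * m + 1) / n] is rewritten by dividing above and below by
   [m + 1]. *)
have -> : (fun m => density (occurrences u) (m + k.+1)) =
  (fun m => (2 - harmonic m) * (1 + k%:R * harmonic m)^-1 *
    ((catalan m)%:R / (catalan (m + k.+1))%:R)).
  apply/funext => m; rewrite /density sum_occurrences -/k addnK.
  rewrite ifT; last by lia.
  rewrite natrM [(2 * m + 1)%:R]natrD natrM natrD /harmonic /= -(natr1 k) -(natr1 m).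
  have m0 : 0 <= m%:R :> R by [].
  have k0 : 0 <= k%:R :> R by [].
  have c1 : (catalan (m + k.+1))%:R != 0 :> R by rewrite pnatr_eq0 -lt0n catalan_gt0.
  field; rewrite c1 /=; lra.
have -> : 4^-1 ^+ k / 2 = (2 - 0) * (1 + k%:R * 0)^-1 * 4^-1 ^+ k.+1 :> R.
  by rewrite exprS; field.
apply: cvgM; last exact: cvg_catalan_ratio.
apply: cvgM; first by apply: cvgB; [exact: cvg_cst|exact: cvg_harmonic].
apply: cvgV; first by rewrite mulr0 addr0.
apply: cvgD; first exact: cvg_cst.
by apply: cvgM; [exact: cvg_cst|exact: cvg_harmonic].
Qed.

Lemma density_left_count_ge (P : pred tree) h n :
  \sum_(u <- trees h | P u) density (occurrences u) n <= density (left_count P) n.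
Proof.
rewrite /density -big_distrl /= ler_wpM2r //.
rewrite -natr_sum ler_nat exchange_big /=.
by apply: leq_sum => t _; apply: occurrences_left_count; exact: trees_uniq.
Qed.

(** A height [h] whose partial sum already exceeds [x] leaves only finitely many left subtrees,
    whose densities converge together. This yields lower bounds only. *)
Lemma density_left_count_eventually (P : pred tree) (p : R) :
  (fun h => \sum_(u <- trees h | P u) (4^-1 ^+ nodes u / 2)) @ \oo --> p ->
  forall x, x < p -> \forall n \near \oo, x < density (left_count P) n.
Proof.
move=> H x xp.
have [h _ /(_ h (leqnn _)) /= xh] := cvgr_gt p H x xp.
have := @cvg_big_sum R tree (trees h) P (fun u n => density (occurrences u) n)
  (fun u => 4^-1 ^+ nodes u / 2) (fun u _ => @cvg_density_occurrences u).
move=> /(cvgr_gt _)/(_ _ xh); apply: filterS => n /lt_le_trans; apply.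
exact: density_left_count_ge.
Qed.

Lemma density_left_count_C (P : pred tree) n : (0 < n)%N ->
  density (left_count P) n + density (left_count (predC P)) n = 1.
Proof.
move=> n0; rewrite /density -mulrDl -natrD -big_split /=.
have -> : (\sum_(t <- trees n | nodes t == n) (left_count P t + left_count (predC P) t)
    = n * catalan n)%N.
  rewrite /catalan big_distrr; apply: eq_bigr => t /eqP E /=.
  by rewrite muln1 left_count_C.
by rewrite natrM divff // mulf_neq0 // pnatr_eq0 -lt0n // catalan_gt0.
Qed.

Lemma half_weights h (P : pred tree) (S : seq nat) :
  uniq S -> (forall t, P t = (state t \in S)) ->
  \sum_(u <- trees h | P u) (4^-1 ^+ nodes u / 2) = \sum_(s <- S) weight R h s * 2^-1.
Proof.
move=> US PS; rewrite -!big_distrl /=; congr (_ * _).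
under [RHS]eq_bigr do rewrite /weight big_mkcond.
rewrite [RHS]exchange_big big_mkcond; apply: eq_bigr => t _ /=.
rewrite PS; case: ifPn => tS.
  rewrite (bigD1_seq _ tS US) /= eqxx big1 ?addr0 // => s.
  by rewrite eq_sym => /negPf ->.
by rewrite big1_seq // => s /andP[_ sS]; case: eqP sS tS => // -> ->.
Qed.

Let P3 : pred tree := fun u => (best u %% 4 == 3)%N.

Lemma cvg_density_completions : density (left_count P3) @ \oo --> (11^-1 : R).
Proof.
have PS t : P3 t = (state t \in [:: 3; 7])%N.
  by rewrite /P3 -state_mod4; have := state_lt8 t; case: (state t) => [|[|[|[|[|[|[|[]]]]]]]].
have PC t : predC P3 t = (state t \in [:: 0; 1; 2; 4; 5; 6])%N.
  by rewrite /= PS; have := state_lt8 t; case: (state t) => [|[|[|[|[|[|[|[]]]]]]]].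
have [L1 L2] := limit_weights R.
have half S : (fun h => \sum_(s <- S) weight R h s * 2^-1) @ \oo -->
    \sum_(s <- S) limit_weight R s * 2^-1.
  by apply: cvg_big_sum => s _; apply: cvgM; [exact: cvg_weight|exact: cvg_cst].
have H1 : (fun h => \sum_(u <- trees h | P3 u) (4^-1 ^+ nodes u / 2)) @ \oo --> (11^-1 : R).
  under eq_fun do rewrite (half_weights _ _ PS) //.
  rewrite (_ : 11^-1 = \sum_(s <- [:: 3; 7]%N) limit_weight R s * 2^-1); first exact: half.
  by rewrite !big_cons big_nil; lra.
have H2 : (fun h => \sum_(u <- trees h | predC P3 u) (4^-1 ^+ nodes u / 2))
    @ \oo --> (10 / 11 : R).
  under eq_fun do rewrite (half_weights _ _ PC) //.
  rewrite (_ : 10 / 11 = \sum_(s <- [:: 0; 1; 2; 4; 5; 6]%N) limit_weight R s * 2^-1); first exact: half.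
  by rewrite !big_cons big_nil; lra.
(* The limits 1/11 and 10/11 sum to 1, as do the two densities, so the lower bound for the
   complement is the missing upper bound. *)
apply/cvgrPdist_lt => e e0; near=> n.
have n0 : (0 < n)%N by near: n; exact: nbhs_infty_gt.
have h1 : 11^-1 - e < density (left_count P3) n.
  by near: n; apply: (density_left_count_eventually H1); lra.
have h2 : 10 / 11 - e < density (left_count (predC P3)) n.
  by near: n; apply: (density_left_count_eventually H2); lra.
have := density_left_count_C P3 n0.
by rewrite ltr_distlC => E; apply/andP; split; lra.
Unshelve. all: by end_near. Qed.

(** A left inverse of [word], found by search. It expresses [best] as a function of words, the form
    required by [sum_avoiders]; the default [Leaf] only matters for words of no tree. *)
Definition decode (s : seq nat) : tree :=
  head Leaf [seq t <- trees (size s) | word t == s].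

Lemma wordK : cancel word decode.
Proof.
move=> t; rewrite /decode; set s := [seq _ <- _ | _].
have ts : t \in s by rewrite mem_filter eqxx mem_trees // size_word.
have : all (fun u => word u == word t) s by exact: filter_all.
by case: s ts => //= u s _ /andP[/eqP /word_inj].
Qed.

Lemma card_avoiders n : #|avoiders tau132 n| = catalan n.
Proof. by rewrite -sum1_card (@sum_avoiders nat n (fun=> 1%N)). Qed.

(** Summation of two bounds: [best] exceeds the longest length by at most 4, and it exceeds 4 times
    its quotient by at most 3. *)
Lemma sum_longest_repeating n :
  let L := (\sum_(sigma in avoiders tau132 n)
     longest_repeating [:: true; true; true; false] sigma)%N in
  let S := (\sum_(t <- trees n | nodes t == n) left_count P3 t)%N in
  (4 * S <= L + 4 * catalan n)%N /\ (L <= 4 * S + 3 * catalan n)%N.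
Proof.
move=> L S.
have bounds sigma : sigma \in avoiders tau132 n ->
    (best (decode (oneline sigma)) <=
       longest_repeating [:: true; true; true; false] sigma + 4)%N /\
    (longest_repeating [:: true; true; true; false] sigma <=
       best (decode (oneline sigma)))%N.
  move=> /avoidersP /(avoids132_word (perm_oneline sigma)) [t E].
  by rewrite -E wordK; exact: longest_repeating_best.
have sumB : (\sum_(sigma in avoiders tau132 n) best (decode (oneline sigma)) =
    \sum_(t <- trees n | nodes t == n) best t)%N.
  rewrite (sum_avoiders n (fun s => best (decode s))).
  by apply: eq_bigr => t _; rewrite wordK.
split.
  rewrite -card_avoiders [(4 * #|_|)%N]mulnC -sum_nat_const -big_split /=.
  apply: (@leq_trans (\sum_(sigma in avoiders tau132 n) best (decode (oneline sigma)))).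
    rewrite sumB /S big_distrr; apply: leq_sum => t _ /=.
    by rewrite -best_div4; lia.
  by apply: leq_sum => sigma /bounds[].
apply: (@leq_trans (\sum_(sigma in avoiders tau132 n) best (decode (oneline sigma)))).
  by apply: leq_sum => sigma /bounds[].
rewrite sumB /S /catalan !big_distrr -big_split; apply: leq_sum => t _ /=.
by rewrite -best_div4; lia.
Qed.

End Asymptotics.

Theorem theorem2 (R : realType) :
  asymp_equiv
    (fun n : nat =>
       Eav tau132
         (fun sigma : 'S_n => (longest_repeating [:: U; U; U; D] sigma)%:R : R))
    (fun n : nat => 4 / 11 * n%:R).
Proof.
have main : (fun n => 11 * density R (left_count (fun u => best u %% 4 == 3)%N) n)
    @ \oo --> (11 * 11^-1 : R).
  by apply: cvgM; [exact: cvg_cst|exact: cvg_density_completions].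
have error : (fun n => 11 / n%:R : R) @ \oo --> (11 * 0 : R).
  apply: cvgM; first exact: cvg_cst.
  by rewrite -cvg_shiftS; exact: cvg_harmonic.
(* The ratio equals 11/4 times the total length over [n * catalan n]. That total differs from 4
   times the total left count by at most [4 * catalan n], whence the error [11 / n]. *)
apply: (@squeeze_cvgr _ _ _ _
  (fun n => 11 * (density R (left_count (fun u => best u %% 4 == 3)%N) n) - 11 / n%:R)
  (fun n => 11 * (density R (left_count (fun u => best u %% 4 == 3)%N) n) + 11 / n%:R)).
- near=> n.
  have n0 : (0 < n%:R :> R) by rewrite ltr0n; near: n; exact: nbhs_infty_gt.
  have c0 : (0 < (catalan n)%:R :> R) by rewrite ltr0n catalan_gt0.
  have [] := sum_longest_repeating n.
  rewrite /Eav /density card_avoiders -natr_sum.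
  set L := (\sum_(sigma in _) _)%N; set S := (\sum_(t <- _ | _) _)%N.
  rewrite -!(ler_nat R) [(L + _)%:R]natrD [(4 * S + _)%:R]natrD !natrM.
  move: L%:R S%:R => {}L {}S H1 H2.
  rewrite (_ : L / (catalan n)%:R / (4 / 11 * n%:R) = L * 11 / 4 / (n%:R * (catalan n)%:R)); last first.
    by field; lra.
  rewrite (_ : 11 / n%:R = 11 * (catalan n)%:R / (n%:R * (catalan n)%:R)); last first.
    by field; lra.
  rewrite mulrA -mulrBl -mulrDl !ler_pM2r ?invr_gt0 ?mulr_gt0 //; lra.
- by have := cvgB main error; rewrite mulr0 subr0 divff // => /(_ _); apply.
- by have := cvgD main error; rewrite mulr0 addr0 divff // => /(_ _); apply.
Unshelve. all: by end_near. Qed.
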